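(* Let $n\ge 1$. The set of all $(\lambda_1,\dots,\lambda_n)\in\mathbb{R}^n$ for which there exists an $n\times n$ real symmetric matrix with all entries nonnegative whose eigenvalues, counted with multiplicity, are $\lambda_1,\dots,\lambda_n$ (in some order) is a semi-algebraic subset of $\mathbb{R}^n$.
   Context: A semi-algebraic subset of $\mathbb{R}^n$ is a set of the form $\bigcup_{i=1}^s\bigcap_{j=1}^{r_i}\{x\in\mathbb{R}^n : f_{i,j}(x) *_{i,j} 0\}$, where $f_{i,j}\in\mathbb{R}[X_1,\dots,X_n]$ and each $*_{i,j}$ is one of $>$, $\ge$, $=$. *)

(* Defs.v *)
From mathcomp Require Import all_boot all_order all_algebra.
From mathcomp Require Import classical_sets reals.
From mathcomp Require Import mpoly.

Set Implicit Arguments.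
Unset Strict Implicit.
Unset Printing Implicit Defensive.

Import Order.TTheory GRing.Theory Num.Theory.
Local Open Scope classical_set_scope.
Local Open Scope ring_scope.

Inductive sign_cond := Gt0 | Ge0 | Eq0.

Definition sign_cond_holds (R : rcfType) (c : sign_cond) (t : R) : Prop :=
  match c with
  | Gt0 => 0 < t
  | Ge0 => 0 <= t
  | Eq0 => t = 0
  end.

(* As usual, the empty union (s = 0) is the empty set and an empty
   intersection (r i = 0) is the whole space. *)
Definition semialgebraic (R : rcfType) (n : nat) (S : set 'rV[R]_n) : Prop :=
  exists (s : nat) (r : 'I_s -> nat)
         (f : forall i : 'I_s, 'I_(r i) -> {mpoly R[n]})
         (c : forall i : 'I_s, 'I_(r i) -> sign_cond),
    S = \bigcup_(i : 'I_s) \bigcap_(j : 'I_(r i))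
          [set x : 'rV[R]_n | sign_cond_holds (c i j) (f i j).@[x ord0]].

Definition symmetric_mx (R : rcfType) (n : nat) (A : 'M[R]_n) : Prop :=
  A^T = A.

Definition nonneg_mx (R : rcfType) (n : nat) (A : 'M[R]_n) : Prop :=
  forall i j, 0 <= A i j.

(* The coordinates of l are, in some order, the eigenvalues of A counted with
   multiplicity: the roots of the characteristic polynomial with their
   multiplicities.  See has_spectrum_eigenvalue and has_spectrumP below. *)
Definition has_spectrum (R : fieldType) (n : nat) (A : 'M[R]_n)
    (l : 'rV[R]_n) : Prop :=
  char_poly A = \prod_(i < n) ('X - (l ord0 i)%:P).

Lemma has_spectrum_eigenvalue (R : fieldType) (n : nat) (A : 'M[R]_n)
    (l : 'rV[R]_n) (a : R) :
  has_spectrum A l -> eigenvalue A a = [exists i, l ord0 i == a].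
Proof.
move=> lA; rewrite eigenvalue_root_char lA -(big_map (l ord0) xpredT
  (fun b => 'X - b%:P)) root_prod_XsubC.
apply/mapP/existsP => [[i _ ->]|[i /eqP <-]]; first by exists i.
by exists i; rewrite ?mem_index_enum.
Qed.

Lemma prod_XsubC_dvd_mup (R : fieldType) (p : {poly R}) (s : seq R) :
  p != 0 -> (forall a, (count_mem a s <= mup a p)%N) ->
  \prod_(a <- s) ('X - a%:P) %| p.
Proof.
elim: s p => [|b s IHs] p p0 le_mu; first by rewrite big_nil dvd1p.
have : 'X - b%:P %| p.
  by rewrite XsubC_dvd//; apply: leq_trans (le_mu b); rewrite /= eqxx.
case/dvdpP => q pE; rewrite pE big_cons mulrC dvdp_mul2r ?polyXsubC_eq0//.
have q0 : q != 0 by apply: contraNneq p0; rewrite pE => ->; rewrite mul0r.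
apply: IHs => // a; have := le_mu a.
rewrite pE mupM ?polyXsubC_eq0//= (@mup_XsubCX _ 1) addnC.
by case: (b == a); rewrite ?leq_add2r ?addn0.
Qed.

Lemma has_spectrumP (R : fieldType) (n : nat) (A : 'M[R]_n) (l : 'rV[R]_n) :
  has_spectrum A l <->
  forall a : R, #|[pred i | l ord0 i == a]| = mup a (char_poly A).
Proof.
pose s := [seq l ord0 i | i <- enum 'I_n].
have sE : \prod_(i < n) ('X - (l ord0 i)%:P) = \prod_(a <- s) ('X - a%:P).
  by rewrite big_map big_enum.
have cE a : #|[pred i | l ord0 i == a]| = count_mem a s.
  by rewrite count_map cardE size_filter -enumT.
rewrite /has_spectrum sE; split=> [-> a|mu_s]; first by rewrite mu_prod_XsubC.
have dvd_s : \prod_(a <- s) ('X - a%:P) %| char_poly A.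
  apply: prod_XsubC_dvd_mup => [|a]; last by rewrite -cE mu_s.
  by rewrite monic_neq0 ?char_poly_monic.
apply/eqP; rewrite eq_sym -eqp_monic ?char_poly_monic ?monic_prod_XsubC//.
rewrite -dvdp_size_eqp// size_prod_XsubC size_char_poly size_map.
by rewrite size_enum_ord.
Qed.

(* Main.v *)
Require Import Defs.
From mathcomp Require Import all_boot all_order all_algebra.
From mathcomp Require Import classical_sets reals.
From mathcomp Require Import mpoly ordered_qelim.
From mathcomp Require qe_rcf.

(** The set in question is a projection.  Let T be the set of the pairs (l, A)
    in R^n x R^(n * n) such that A is symmetric, has nonnegative entries, and
    has the characteristic polynomial prod_i (X - l_i).  Each of these
    conditions is a polynomial equation or inequality in the coordinates of
    (l, A): the last one says that the coefficients of the two polynomials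
    agree, and these coefficients are polynomials in the entries of l and A.
    So T is semi-algebraic, and the spectra sought are the image of T under
    (l, A) |-> l.  The theorem of Tarski and Seidenberg
    ([semialgebraic_proj]) concludes.

    That theorem is obtained by passing through first-order formulas.  A
    semi-algebraic set is defined by a formula ([semialgebraic_formula]);
    projecting along m coordinates amounts to putting m existential
    quantifiers in front of it ([holds_exists_block]); and any formula, with
    or without quantifiers, defines a semi-algebraic set
    ([semialgebraic_holds]), because quantifier elimination over real closed
    fields makes it quantifier-free, and the disjunctive normal form of a
    quantifier-free formula is a finite union of finite intersections of sign
    conditions.

    The polynomials defining T come from a single generic matrix: its entries
    are distinct variables, and evaluation of polynomials is a ring morphism,
    hence commutes with taking the characteristic polynomial
    ([map_spectrum_defect]). *)

Set Implicit Arguments.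
Unset Strict Implicit.
Unset Printing Implicit Defensive.

Import Order.TTheory GRing.Theory Num.Theory.

Local Open Scope classical_set_scope.
Local Open Scope ring_scope.

(** * Disjunctive normal forms *)

Section Disjunctive.
Variables (R : rcfType) (n : nat).
Implicit Types (x : 'rV[R]_n) (a : sign_cond * {mpoly R[n]}).

Definition sat x a : bool :=
  let t := a.2.@[x ord0] in
  match a.1 with Gt0 => 0 < t | Ge0 => 0 <= t | Eq0 => t == 0 end.

Lemma satP x a : reflect (sign_cond_holds a.1 a.2.@[x ord0]) (sat x a).
Proof.
by case: a => -[] p; rewrite /sat /=; [apply: idP|apply: idP|apply: eqP].
Qed.

Lemma semialgebraic_dnf (s : seq (seq (sign_cond * {mpoly R[n]}))) :
  semialgebraic [set x | has (all (sat x)) s].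
Proof.
pose cl (i : 'I_(size s)) := nth [::] s i.
pose lit i (j : 'I_(size (cl i))) := nth (Eq0, 0) (cl i) j.
exists (size s), (fun i => size (cl i)), (fun i j => (lit i j).2),
  (fun i j => (lit i j).1).
apply/seteqP; split=> x /=.
  case/(has_nthP [::]) => i ilt /(all_nthP (Eq0, 0)) xi.
  by exists (Ordinal ilt) => // j _; apply/satP/xi/(ltn_ord j).
case=> i _ xi; apply/(has_nthP [::]); exists i; first exact: ltn_ord.
apply/(all_nthP (Eq0, 0)) => j jlt.
by apply/satP; apply: (xi (Ordinal jlt)).
Qed.

Lemma semialgebraic_basic (I : finType) (c : I -> sign_cond)
    (f : I -> {mpoly R[n]}) :
  semialgebraic
    [set x : 'rV[R]_n | forall i, sign_cond_holds (c i) (f i).@[x ord0]].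
Proof.
have -> : [set x : 'rV[R]_n | forall i, sign_cond_holds (c i) (f i).@[x ord0]]
    = [set x | has (all (sat x)) [:: [seq (c i, f i) | i <- enum I]]].
  apply/seteqP; split=> x /=; rewrite orbF all_map.
    by move=> xI; apply/allP => i _ /=; apply/satP/xI.
  by move/allP => xI i; apply/(satP x (c i, f i))/xI; rewrite mem_enum.
exact: semialgebraic_dnf.
Qed.

End Disjunctive.

(** * Formulas and semi-algebraic sets *)

Section Definable.
Variable R : rcfType.

Definition env n (x : 'rV[R]_n) : seq R := [seq x ord0 i | i <- enum 'I_n].

Lemma size_env n (x : 'rV[R]_n) : size (env x) = n.
Proof. by rewrite size_map size_enum_ord. Qed.

Lemma nth_env n (x : 'rV[R]_n) (i : 'I_n) : (env x)`_i = x ord0 i.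
Proof. by rewrite (nth_map i) ?size_enum_ord// nth_ord_enum. Qed.

Lemma env_row_mx n m (x : 'rV[R]_n) (y : 'rV[R]_m) :
  env (row_mx x y) = env x ++ env y.
Proof.
apply: (@eq_from_nth _ 0); first by rewrite size_cat !size_env.
move=> i; rewrite size_env => ilt; rewrite nth_cat size_env.
rewrite (nth_env _ (Ordinal ilt)).
case: (splitP (Ordinal ilt)) => [j|k] /= iE.
  have -> : Ordinal ilt = lshift m j by exact: val_inj.
  by rewrite row_mxEl iE nth_env.
have -> : Ordinal ilt = rshift n k by exact: val_inj.
by rewrite row_mxEr iE addKn nth_env.
Qed.

Lemma env_surj n (s : seq R) : size s = n -> exists x : 'rV[R]_n, env x = s.
Proof.
move=> sn; exists (\row_i s`_i); apply: (@eq_from_nth _ 0).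
  by rewrite size_env.
by move=> i; rewrite size_env => ilt; rewrite (nth_env _ (Ordinal ilt)) mxE.
Qed.

(** A variable of index at least n is sent to 0 because the valuation [env x]
    has length n and reads as 0 beyond it.  The value at an inverse is junk:
    only terms in the language of rings are translated. *)
Fixpoint mpoly_of_term n (t : GRing.term R) : {mpoly R[n]} :=
  match t with
  | GRing.Var i => if insub i is Some j then 'X_j else 0
  | GRing.Const a => a%:MP
  | GRing.NatConst k => k%:R
  | GRing.Add t1 t2 => mpoly_of_term n t1 + mpoly_of_term n t2
  | GRing.Opp t1 => - mpoly_of_term n t1
  | GRing.NatMul t1 k => mpoly_of_term n t1 *+ k
  | GRing.Mul t1 t2 => mpoly_of_term n t1 * mpoly_of_term n t2
  | GRing.Inv _ => 0
  | GRing.Exp t1 k => mpoly_of_term n t1 ^+ k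
  end.

Lemma meval_mpoly_of_term n (x : 'rV[R]_n) (t : GRing.term R) :
  GRing.rterm t -> (mpoly_of_term n t).@[x ord0] = GRing.eval (env x) t.
Proof.
elim: t => //=.
- move=> i _; case: insubP => [j _ <-|]; first by rewrite mevalXU nth_env.
  by rewrite -leqNgt => ni; rewrite meval0 nth_default ?size_env.
- by move=> a _; rewrite mevalC.
- by move=> k _; rewrite rmorph_nat.
- by move=> t1 IH1 t2 IH2 /andP[/IH1 <- /IH2 <-]; rewrite mevalD.
- by move=> t1 IH1 /IH1 <-; rewrite mevalN.
- by move=> t1 IH1 k /IH1 <-; rewrite mevalMn.
- by move=> t1 IH1 t2 IH2 /andP[/IH1 <- /IH2 <-]; rewrite mevalM.
- by move=> t1 IH1 k /IH1 <-; rewrite rmorphXn.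
Qed.

Definition term_of_mpoly n (p : {mpoly R[n]}) : GRing.term R :=
  \big[GRing.Add/GRing.NatConst R 0]_(m <- msupp p)
    GRing.Mul (GRing.Const p@_m)
      (\big[GRing.Mul/GRing.NatConst R 1]_(i < n)
         GRing.Exp (GRing.Var R i) (m i)).

Lemma eval_term_of_mpoly n (x : 'rV[R]_n) (p : {mpoly R[n]}) :
  GRing.eval (env x) (term_of_mpoly p) = p.@[x ord0].
Proof.
rewrite mevalE (@big_morph _ _ (GRing.eval (env x)) 0 +%R)//.
apply: eq_bigr => m _ /=; congr (_ * _).
rewrite (@big_morph _ _ (GRing.eval (env x)) 1 *%R)//.
by apply: eq_bigr => i _ /=; rewrite nth_env.
Qed.

(** A disequation t <> 0 is not one of the three sign conditions; it becomes
    the strict inequality 0 < t ^ 2. *)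
Definition literals_of_oclause n (bc : ord.oclause R) :
    seq (sign_cond * {mpoly R[n]}) :=
  let: ord.Oclause eqs neqs lts les := bc in
  let P := mpoly_of_term n in
  [seq (Eq0, P t) | t <- eqs] ++ [seq (Gt0, P t ^+ 2) | t <- neqs] ++
  [seq (Gt0, P t) | t <- lts] ++ [seq (Ge0, P t) | t <- les].

Lemma sat_literals_of_oclause n (x : 'rV[R]_n) (bcs : seq (ord.oclause R)) :
  all (@ord.dnf_rterm R) bcs ->
  has (all (sat x)) [seq literals_of_oclause n bc | bc <- bcs]
    = ord.qf_eval (env x) (ord.odnf_to_oform bcs).
Proof.
elim: bcs => //= -[eqs neqs lts les] bcs IH /andP[+ /IH <-].
rewrite /ord.dnf_rterm /= => /and4P[req rneq rlt rle]; congr (_ || _).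
rewrite !all_cat !all_map.
have foldE ts (P : pred (GRing.term R)) (F : GRing.term R -> ord.formula R) :
    all (@GRing.rterm R) ts ->
    (forall t, GRing.rterm t -> P t = ord.qf_eval (env x) (F t)) ->
    all P ts = ord.qf_eval (env x)
                 (foldr (fun t => ord.And (F t)) (ord.Bool true) ts).
  by move=> + PF; elim: ts => //= t ts IHt /andP[/PF <- /IHt <-].
congr [&& _, _, _ & _]; apply: foldE => // t rt;
  rewrite /sat /= ?rmorphXn/= meval_mpoly_of_term//.
by rewrite lt0r sqr_ge0 andbT sqrf_eq0.
Qed.

(** Quantifier elimination first turns F into a quantifier-free formula G in
    the language of rings, the one to which normal forms apply. *)
Lemma semialgebraic_holds n (F : ord.formula R) :
  semialgebraic [set x : 'rV[R]_n | ord.holds (env x) F].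
Proof.
pose proj i bc := qe_rcf.qfr_to_formula (@qe_rcf.wproj R i bc).
pose G := ord.quantifier_elim proj (ord.to_rform F).
have Gwf : ord.qf_form G && ord.rformula G.
  apply: ord.quantifier_elim_wf (ord.to_rform_rformula F).
  exact: qe_rcf.wf_QE_wproj.
pose bcs := ord.qf_to_odnf G false.
have -> : [set x : 'rV[R]_n | ord.holds (env x) F]
    = [set x | has (all (sat x)) [seq literals_of_oclause n bc | bc <- bcs]].
  apply/seteqP; split=> x /=; rewrite sat_literals_of_oclause ?ord.qf_to_dnfP//.
  - by move/qe_rcf.rcf_satP.
  - by apply: ord.qf_to_dnf_rterm; case/andP: Gwf.
  - by move=> xG; apply/qe_rcf.rcf_satP.
  - by apply: ord.qf_to_dnf_rterm; case/andP: Gwf.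
exact: semialgebraic_dnf.
Qed.

Definition literal n (c : sign_cond) (p : {mpoly R[n]}) : ord.formula R :=
  let t := term_of_mpoly p in
  match c with
  | Gt0 => ord.Lt (GRing.NatConst R 0) t
  | Ge0 => ord.Le (GRing.NatConst R 0) t
  | Eq0 => ord.Equal t (GRing.NatConst R 0)
  end.

Lemma holds_literal n (x : 'rV[R]_n) c (p : {mpoly R[n]}) :
  ord.holds (env x) (literal c p) <-> sign_cond_holds c p.@[x ord0].
Proof. by case: c; rewrite /= eval_term_of_mpoly. Qed.

Lemma holds_big_or e k (F : 'I_k -> ord.formula R) :
  ord.holds e (\big[ord.Or/ord.Bool false]_(i < k) F i)
    <-> exists i, ord.holds e (F i).
Proof.
elim: k F => [|k IH] F; first by rewrite big_ord0; split=> // -[[]].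
rewrite big_ord_recl /= IH; split=> [[F0|[i Fi]]|[i]].
- by exists ord0.
- by exists (lift ord0 i).
by case: (unliftP ord0 i) => [j ->|-> ?]; [right; exists j|left].
Qed.

Lemma holds_big_and e k (F : 'I_k -> ord.formula R) :
  ord.holds e (\big[ord.And/ord.Bool true]_(i < k) F i)
    <-> forall i, ord.holds e (F i).
Proof.
elim: k F => [|k IH] F; first by rewrite big_ord0; split=> // _ [].
rewrite big_ord_recl /= IH; split=> [[F0 FS] i|FI]; last by split.
by case: (unliftP ord0 i) => [j ->|->].
Qed.

Lemma semialgebraic_formula n (S : set 'rV[R]_n) :
  semialgebraic S ->
  exists F, forall x : 'rV[R]_n, S x <-> ord.holds (env x) F.
Proof.
case=> s [r [f [c ->]]].
exists (\big[ord.Or/ord.Bool false]_(i < s)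
          \big[ord.And/ord.Bool true]_(j < r i) literal (c i j) (f i j)) => x.
rewrite holds_big_or; split=> [[i _ xi]|[i /holds_big_and xi]].
  by exists i; apply/holds_big_and => j; apply/holds_literal/xi.
by exists i => // j _; apply/holds_literal/xi.
Qed.

(** Assigning a value to the first unused variable lengthens the valuation by
    one entry, so the block of quantifiers spells out a list of m values,
    one entry at a time. *)
Lemma holds_exists_block (F : ord.formula R) (k m : nat) (e : seq R) :
  size e = k ->
  ord.holds e (foldr (@ord.Exists R) F (iota k m))
    <-> exists2 s, size s = m & ord.holds (e ++ s) F.
Proof.
have set_size s (a : R) : set_nth 0 s (size s) a = rcons s a.
  by rewrite set_nthE ltnn subnn -cats1.
elim: m k e => [|m IH] k e <- /=.
  by split=> [eF|[[]// _]]; [exists [::]|]; rewrite ?cats0.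
split=> [[a]|[[|a s]// [sm] eF]]; rewrite ?set_size.
  move/IH; rewrite size_rcons => /(_ erefl)[s sm].
  by rewrite cat_rcons; exists (a :: s); rewrite //= sm.
exists a; rewrite set_size; apply/IH; first exact: size_rcons.
by exists s; rewrite // cat_rcons.
Qed.

(** The theorem of Tarski and Seidenberg: existential quantification does not
    leave the formulas, and formulas define exactly the semi-algebraic sets. *)
Theorem semialgebraic_proj n m (S : set 'rV[R]_(n + m)) :
  semialgebraic S ->
  semialgebraic [set x : 'rV[R]_n | exists y : 'rV[R]_m, S (row_mx x y)].
Proof.
case/semialgebraic_formula => F SF.
have -> : [set x : 'rV[R]_n | exists y : 'rV[R]_m, S (row_mx x y)]
    = [set x | ord.holds (env x) (foldr (@ord.Exists R) F (iota n m))].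
  apply/seteqP; split=> x /=.
    case=> y /SF; rewrite env_row_mx => xyF.
    apply/holds_exists_block; first exact: size_env.
    by exists (env y); rewrite ?size_env.
  case/(holds_exists_block _ _ (size_env x)) => s /env_surj[y <-] xyF.
  by exists y; apply/SF; rewrite env_row_mx.
exact: semialgebraic_holds.
Qed.
End Definable.

(** * The spectra of symmetric nonnegative matrices *)

Section SymmetricNonneg.
Variables (R : rcfType) (n : nat).

Local Notation P := {mpoly R[n + n * n]}.

(** The first n variables stand for the prescribed eigenvalues and the last
    n * n for the entries of the matrix, in the order used by [mxvec]. *)
Definition generic_row : 'rV[P]_n := \row_i 'X_(lshift (n * n) i).

Definition generic_mx : 'M[P]_n :=
  \matrix_(i, j) 'X_(rshift n (mxvec_index i j)).

Lemma meval_generic_row (l : 'rV[R]_n) (A : 'M[R]_n) i :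
  (generic_row ord0 i).@[row_mx l (mxvec A) ord0] = l ord0 i.
Proof. by rewrite mxE mevalXU row_mxEl. Qed.

Lemma meval_generic_mx (l : 'rV[R]_n) (A : 'M[R]_n) i j :
  (generic_mx i j).@[row_mx l (mxvec A) ord0] = A i j.
Proof. by rewrite mxE mevalXU row_mxEr mxvecE. Qed.

Definition spectrum_defect : {poly P} :=
  char_poly generic_mx - \prod_(i < n) ('X - (generic_row ord0 i)%:P).

(** Evaluation is a ring morphism, and both the characteristic polynomial and
    the product of linear factors are natural in the ring. *)
Lemma map_spectrum_defect (l : 'rV[R]_n) (A : 'M[R]_n) :
  map_poly (meval (row_mx l (mxvec A) ord0)) spectrum_defect
    = char_poly A - \prod_(i < n) ('X - (l ord0 i)%:P).
Proof.
rewrite rmorphB /= map_char_poly rmorph_prod; congr (char_poly _ - _).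
  by apply/matrixP => i j; rewrite [LHS]mxE /= meval_generic_mx.
apply: eq_bigr => i _.
by rewrite rmorphB /= map_polyX map_polyC /= meval_generic_row.
Qed.

(** Specialization can only lower the degree, so the coefficients of the
    generic difference, finite in number, detect whether its value
    vanishes. *)
Lemma has_spectrum_defect (l : 'rV[R]_n) (A : 'M[R]_n) :
  has_spectrum A l <->
  forall k : 'I_(size spectrum_defect),
    (spectrum_defect`_k).@[row_mx l (mxvec A) ord0] = 0.
Proof.
have coefE k : (spectrum_defect`_k).@[row_mx l (mxvec A) ord0]
    = (char_poly A - \prod_(i < n) ('X - (l ord0 i)%:P))`_k.
  by rewrite -map_spectrum_defect coef_map.
rewrite /has_spectrum; split=> [lA k|d0]; first by rewrite coefE lA subrr coef0.
apply/eqP; rewrite -subr_eq0; apply/eqP/polyP => k; rewrite coef0 -coefE.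
have [klt|kge] := ltnP k (size spectrum_defect).
  exact: (d0 (Ordinal klt)).
by rewrite nth_default ?meval0.
Qed.

Lemma semialgebraic_symmetric_nonneg_spectrum :
  semialgebraic [set z : 'rV[R]_(n + n * n) |
    let A := vec_mx (rsubmx z) in
    [/\ symmetric_mx A, nonneg_mx A & has_spectrum A (lsubmx z)]].
Proof.
(* One sign condition for each pair (i, j) expressing symmetry, for each pair
   expressing nonnegativity, and for each coefficient of the defect. *)
pose I : finType :=
  ('I_n * 'I_n + 'I_n * 'I_n + 'I_(size spectrum_defect))%type.
pose c (i : I) := match i with inl (inr _) => Ge0 | _ => Eq0 end.
pose f (i : I) := match i with
  | inl (inl ij) => generic_mx ij.2 ij.1 - generic_mx ij.1 ij.2
  | inl (inr ij) => generic_mx ij.1 ij.2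
  | inr k => spectrum_defect`_k
  end.
set S := [set z | _].
suff -> : S = [set z : 'rV[R]_(n + n * n) |
    forall i, sign_cond_holds (c i) (f i).@[z ord0]]
  by exact: semialgebraic_basic.
apply/seteqP; split=> z; rewrite /S /=; set A := vec_mx _; set l := lsubmx z;
  have -> : z = row_mx l (mxvec A) by rewrite vec_mxK hsubmxK.
  case=> symA nnA /has_spectrum_defect lA [[[i j]|[i j]]|k] /=.
  - rewrite mevalB !meval_generic_mx -[in A j i]symA mxE subrr//.
  - by rewrite meval_generic_mx; apply: nnA.
  - exact: lA.
move=> zI; split.
- apply/matrixP => i j; rewrite mxE; apply/eqP; rewrite -subr_eq0; apply/eqP.
  by have := zI (inl (inl (i, j))); rewrite /= mevalB !meval_generic_mx.
- by move=> i j; have := zI (inl (inr (i, j))); rewrite /= meval_generic_mx.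
- by apply/has_spectrum_defect => k; apply: (zI (inr k)).
Qed.
End SymmetricNonneg.

Theorem corollary3p3 (R : realType) (n : nat) (n_ge1 : (1 <= n)%N) :
  semialgebraic
    [set l : 'rV[R]_n |
       exists A : 'M[R]_n,
         [/\ symmetric_mx A, nonneg_mx A & has_spectrum A l]].
Proof.
have := semialgebraic_proj (semialgebraic_symmetric_nonneg_spectrum R n).
congr semialgebraic; apply/seteqP; split=> l /=.
  by case=> y; rewrite row_mxKl row_mxKr => Ay; exists (vec_mx y).
case=> A Al; exists (mxvec A).
by rewrite row_mxKl row_mxKr mxvecK.
Qed.
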